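(* Let $W:S_C\rightsquigarrow\hat S_C$ be a carrier channel kernel with Shannon capacity $C(W)$. (i) Any $(n,M)$ semantic block code with $P_e^{(n)}\le\epsilon$ satisfies $\log M\le\frac{nC(W)+1}{1-\epsilon}$. (ii) If $d=d_{\mathrm{sem}}$ with $\alpha>0$, then $D_{\max}^{(n)}(d_{\mathrm{sem}})\ge\alpha P_e^{(n)}$; so $D^{(n)}_{\max}\to0$ implies $P_e^{(n)}\to0$ and (i) applies. (iii) Assume that for any two distinct $a_1,a_2\in\mathrm{Atom}(S_O)$ one has $R_{\mathrm{Cn}}(a_1)\cap R_{\mathrm{Cn}}(a_2)=\varnothing$, where $R_{\mathrm{Cn}}(m):=\{\hat s_o\in\hat S_O: d_{\mathrm{Cn}}(m,\hat s_o\mid S_O)=0\}$. Then any $(n,|S_O|)$ code with message set $S_O$ and $P^{(n)}_{e,\mathrm{Cn}}\le\epsilon$ satisfies $\log|\mathrm{Atom}(S_O)|\le\frac{nC(W)+1}{1-\epsilon}$. (iv) $M\le|S_O|$ for any message set.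
   Context: Setting: countable semantic universe $\mathbb S_O$ with deductive closure operator $\mathrm{Cn}$ (reflexive, monotone, idempotent) from a fixed proof system, and immediate-consequence iterates $T^n$ with $\mathrm{Cn}(\Gamma)=\bigcup_nT^n(\Gamma)$. $S_O\subseteq\mathbb S_O$ is a finite knowledge base listed in a canonical order; $\mathrm{Atom}(S_O)$ is obtained by scanning $S_O$ in canonical order from $A=S_O$ and deleting $s$ whenever $s\in\mathrm{Cn}(A\setminus\{s\})$. $\mathrm{Dd}(s\mid B)=\min\{n:s\in T^n(B)\}$ ($\infty$ if $s\notin\mathrm{Cn}(B)$). $S_C,\hat S_C$ are finite carrier alphabets, $\hat S_O\subseteq\mathbb S_O$ is finite, $W$ a Markov kernel, $W^{\otimes n}(\hat s^n\mid s^n)=\prod_iW(\hat s^{(i)}\mid s^{(i)})$, $C(W)=\max_{P_C}I(\mathsf S_c;\hat{\mathsf S}_c)$, logs base 2, $0\le\epsilon<1$. An $(n,M)$ semantic block code: message set $\mathcal M\subseteq S_O$ with $|\mathcal M|=M$, encoder $f_n:\mathcal M\to S_C^n$, decoder $g_n:\hat S_C^n\to\hat S_O$; for $m\in\mathcal M$, $\hat{\mathsf S}^{(m)}=g_n(\hat{\mathsf S}^n_c)$ where $\hat{\mathsf S}^n_c\sim W^{\otimes n}(\cdot\mid f_n(m))$. $P_e^{(n)}:=\max_m\Pr[\hat{\mathsf S}^{(m)}\ne m]$; $D^{(n)}_{\max}(d):=\max_m\mathbb E[d(m,\hat{\mathsf S}^{(m)})]$; $P^{(n)}_{e,\mathrm{Cn}}:=\max_m\Pr[d_{\mathrm{Cn}}(m,\hat{\mathsf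 S}^{(m)}\mid S_O)>0]$. Distortions: $d_H(s,\hat s)=\mathbf 1[s\ne\hat s]$. For a finite reference base $\Gamma\subseteq\mathbb S_O$, with $\Gamma_{-s}=\Gamma\setminus\{s\}$, $C_s=\mathrm{Cn}(\Gamma_{-s}\cup\{s\})$, $C_{\hat s}=\mathrm{Cn}(\Gamma_{-s}\cup\{\hat s\})$, $d_{\mathrm{Cn}}(s,\hat s\mid\Gamma)=1-|C_s\cap C_{\hat s}|/|C_s\cup C_{\hat s}|$ ($0/0:=0$). With $A=\mathrm{Atom}(S_O)$ and $d_{\max}=\max_{q\in S_O}\mathrm{Dd}(q\mid A)$: $d_{\mathrm{Dd}}(s,\hat s)=\min(|\mathrm{Dd}(s\mid A)-\mathrm{Dd}(\hat s\mid A)|/\max(d_{\max},1),1)$ if $\hat s\in\mathrm{Cn}(A)$, and $1$ otherwise. For weights $\alpha,\beta,\gamma\ge0$, $\alpha+\beta+\gamma=1$, and a reference base $\Gamma$: $d_{\mathrm{sem}}=\alpha d_H+\beta d_{\mathrm{Cn}}(\cdot,\cdot\mid\Gamma)+\gamma d_{\mathrm{Dd}}$. *)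

(* Defs.v *)
From HB Require Import structures.
From mathcomp Require Import all_boot all_order all_algebra.
From mathcomp Require Import finmap.
From mathcomp Require Import all_classical all_reals all_analysis.

Set Implicit Arguments.
Unset Strict Implicit.
Unset Printing Implicit Defensive.

Import Order.TTheory GRing.Theory Num.Theory.
Import numFieldNormedType.Exports.

Local Open Scope classical_set_scope.
Local Open Scope ring_scope.

(* [iter n (conseq ps) G] is T^n(G); in particular T^0(G) = G. *)
Record proof_system (U : Type) := ProofSystem {
  Cn : set U -> set U;
  conseq : set U -> set U;
  Cn_refl : forall G, G `<=` Cn G;
  Cn_mono : forall G D, G `<=` D -> Cn G `<=` Cn D;
  Cn_idem : forall G, Cn (Cn G) = Cn G;
  Cn_conseq : forall G, Cn G = \bigcup_n iter n conseq G }.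

(* [order] lists the elements of the base SO in its canonical order. *)
Definition canonical_order (U : countType) (SO : {fset U}) (order : seq U) :
    Prop :=
  uniq order /\ order =i SO.

Definition Atom (U : countType) (ps : proof_system U)
    (SO : {fset U}) (order : seq U) : {fset U} :=
  foldl (fun (A : {fset U}) (s : U) =>
           if `[< Cn ps [set` (A `\ s)%fset] s >] then (A `\ s)%fset else A)
        SO order.

Definition Dd (R : realType) (U : countType) (ps : proof_system U)
    (s : U) (B : set U) : \bar R :=
  match pselect (exists n, `[< iter n (conseq ps) B s >]) with
  | left h => (ex_minn h)%:R%:E
  | right _ => +oo%E
  end.

Definition dH (R : realType) (U : countType) (s t : U) : R := (s != t)%:R.

(* Closures of finite sets may be infinite, in which case |X n Y| / |X u Y| has
   no canonical value: J supplies the value used then.  When X u Y is finite,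
   this is the usual ratio, with 0 / 0 = 0. *)
Definition jaccard (R : realType) (U : countType) (J : set U -> set U -> R)
    (X Y : set U) : R :=
  if `[< finite_set (X `|` Y) >]
  then #|` fset_set (X `&` Y)|%:R / #|` fset_set (X `|` Y)|%:R
  else J X Y.

Definition dCn (R : realType) (U : countType) (ps : proof_system U)
    (J : set U -> set U -> R) (G : {fset U}) (s t : U) : R :=
  1 - jaccard J (Cn ps [set` (s |` (G `\ s))%fset])
                (Cn ps [set` (t |` (G `\ s))%fset]).

Definition Dd_max (R : realType) (U : countType) (ps : proof_system U)
    (SO A : {fset U}) : \bar R :=
  \big[maxe/0%E]_(q <- SO) Dd R ps q [set` A].

(* All quantities below are finite when s is in SO, so that [fine] only
   converts the result, which lies between 0 and 1, to a real number. *)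
Definition dDd (R : realType) (U : countType) (ps : proof_system U)
    (SO : {fset U}) (order : seq U) (s t : U) : R :=
  let A := Atom ps SO order in
  if `[< Cn ps [set` A] t >] then
    fine (mine (`|Dd R ps s [set` A] - Dd R ps t [set` A]|
                  / maxe (Dd_max R ps SO A) 1) 1)%E
  else 1.

Definition dsem (R : realType) (U : countType) (ps : proof_system U)
    (J : set U -> set U -> R) (SO : {fset U}) (order : seq U) (G : {fset U})
    (alpha beta gamma : R) (s t : U) : R :=
  alpha * dH R s t + beta * dCn ps J G s t + gamma * dDd R ps SO order s t.

Definition log2 (R : realType) (x : R) : R := ln x / ln 2.

Definition is_dist (R : realType) (X : finType) (p : X -> R) : Prop :=
  (forall x, 0 <= p x) /\ \sum_x p x = 1.

(* [W x y] is the probability W(y | x). *)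
Definition markov_kernel (R : realType) (X Y : finType) (W : X -> Y -> R) :
    Prop :=
  forall x, is_dist (W x).

Definition mutual_info (R : realType) (X Y : finType) (p : X -> Y -> R) : R :=
  \sum_x \sum_y
    p x y * log2 (p x y / ((\sum_y' p x y') * (\sum_x' p x' y))).

(* The supremum is attained when X is nonempty: mutual information is continuous
   in the input distribution, which ranges over a compact simplex. *)
Definition capacity (R : realType) (X Y : finType) (W : X -> Y -> R) : R :=
  sup [set mutual_info (fun x y => P x * W x y) | P in @is_dist R X].

Definition kernel_pow (R : realType) (X Y : finType) (W : X -> Y -> R) (n : nat)
    (x : n.-tuple X) (y : n.-tuple Y) : R :=
  \prod_(i < n) W (tnth x i) (tnth y i).

Record semantic_code (U : countType) (SO SOh : {fset U}) (SC SCh : finType)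
    (n M : nat) := Code {
  msgs : {fset U};
  msgs_sub : (msgs `<=` SO)%fset;
  msgs_card : #|` msgs| = M;
  enc : msgs -> n.-tuple SC;
  dec : n.-tuple SCh -> SOh }.

Definition Pr (R : realType) (U : countType) (SO SOh : {fset U})
    (SC SCh : finType) (n M : nat) (W : SC -> SCh -> R)
    (c : semantic_code SO SOh SC SCh n M) (m : msgs c) (E : pred U) : R :=
  \sum_(y : n.-tuple SCh | E (val (dec c y))) kernel_pow W (enc m) y.

Definition Ex (R : realType) (U : countType) (SO SOh : {fset U})
    (SC SCh : finType) (n M : nat) (W : SC -> SCh -> R)
    (c : semantic_code SO SOh SC SCh n M) (m : msgs c) (h : U -> R) : R :=
  \sum_(y : n.-tuple SCh) kernel_pow W (enc m) y * h (val (dec c y)).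

Definition Pe (R : realType) (U : countType) (SO SOh : {fset U})
    (SC SCh : finType) (n M : nat) (W : SC -> SCh -> R)
    (c : semantic_code SO SOh SC SCh n M) : R :=
  \big[Num.max/0]_(m : msgs c) Pr W m (fun t => t != val m).

Definition Dmax (R : realType) (U : countType) (SO SOh : {fset U})
    (SC SCh : finType) (n M : nat) (W : SC -> SCh -> R)
    (c : semantic_code SO SOh SC SCh n M) (d : U -> U -> R) : R :=
  \big[Num.max/0]_(m : msgs c) Ex W m (d (val m)).

Definition PeCn (R : realType) (U : countType) (ps : proof_system U)
    (J : set U -> set U -> R) (SO SOh : {fset U})
    (SC SCh : finType) (n M : nat) (W : SC -> SCh -> R)
    (c : semantic_code SO SOh SC SCh n M) : R :=
  \big[Num.max/0]_(m : msgs c) Pr W m (fun t => 0 < dCn ps J SO (val m) t).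

Definition RCn (R : realType) (U : countType) (ps : proof_system U)
    (J : set U -> set U -> R) (SO SOh : {fset U}) (m : U) : set U :=
  [set t | t \in SOh /\ dCn ps J SO m t = 0].

(* Main.v *)
(* Everything rests on one converse bound: if M codewords over n uses of W have
   pairwise disjoint decision regions S_m, each hit with probability at least
   1 - eps, then (1 - eps) log M <= n C(W) + 1.  Instead of entropies and data
   processing, apply Gibbs' inequality once, to the joint law of a uniform
   message and its output against the weights
   Q(y) (M 1[y in S_m] + 1) / (2 M), where Q is the product of the
   coordinatewise output laws.  Disjointness makes the total weight at most 1;
   the divergence term is a sum of n single-letter mutual informations, each at
   most C(W), and the rest is at least (1 - eps) log M - 1.
   For (i) the regions are the decoding preimages of the messages; for (iii)
   only the messages in Atom(SO) are kept, and S_a is the set of outputs decoded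
   into R_Cn(a). *)
Require Import Defs.
From HB Require Import structures.
From mathcomp Require Import all_boot all_order all_algebra.
From mathcomp Require Import finmap.
From mathcomp Require Import all_classical all_reals all_analysis.
From mathcomp Require Import ring lra.

Set Implicit Arguments.
Unset Strict Implicit.
Unset Printing Implicit Defensive.

Import Order.TTheory GRing.Theory Num.Theory.
Import numFieldNormedType.Exports.

Local Open Scope classical_set_scope.
Local Open Scope ring_scope.

(** * Products over tuples and logarithms *)

Lemma sum_tuple_prod (R : comPzSemiRingType) (Y : finType) (n : nat)
    (F : 'I_n -> Y -> R) :
  \sum_(y : n.-tuple Y) \prod_(i < n) F i (tnth y i) =
  \prod_(i < n) \sum_y F i y.
Proof.
rewrite bigA_distr_bigA /=.
rewrite (reindex (fun f : {ffun 'I_n -> Y} => [tuple f i | i < n])).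
  by apply: eq_bigr => f _; apply: eq_bigr => i _; rewrite tnth_mktuple.
exists (fun y : n.-tuple Y => [ffun i => tnth y i]) => [f|y] _.
  by apply/ffunP => i; rewrite ffunE tnth_mktuple.
by apply: eq_from_tnth => i; rewrite tnth_mktuple ffunE.
Qed.

Lemma ln_prod (R : realType) (I : finType) (F : I -> R) :
  (forall i, 0 < F i) -> ln (\prod_i F i) = \sum_i ln (F i).
Proof.
move=> F0.
(* [lnM] needs both factors positive, so positivity of the product is carried through the
   induction. *)
suff [] : 0 < \prod_i F i /\ ln (\prod_i F i) = \sum_i ln (F i) by [].
elim/big_rec2: _ => [|i s p _ [p0 ps]]; first by rewrite ltr01 ln1.
by rewrite mulr_gt0 ?F0 // lnM ?posrE ?F0 // ps.
Qed.

Lemma ln_le_subr1 (R : realType) (x : R) : 0 < x -> ln x <= x - 1.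
Proof.
by move=> x0; have := @le_ln1Dx R (x - 1); rewrite subrKC; apply; lra.
Qed.

(** * Memoryless channels and mutual information *)

Section channel.
Context {R : realType} {X Y : finType} (W : X -> Y -> R).
Context (hW : markov_kernel W).

Let W_ge0 x y : 0 <= W x y. Proof. by case: (hW x). Qed.
Let W_sum x : \sum_y W x y = 1. Proof. by case: (hW x). Qed.

Lemma kernel_pow_ge0 n (x : n.-tuple X) y : 0 <= kernel_pow W x y.
Proof. by apply: prodr_ge0. Qed.

Lemma kernel_pow_sum n (x : n.-tuple X) : \sum_y kernel_pow W x y = 1.
Proof.
by rewrite (sum_tuple_prod (fun i => W (tnth x i))) big1.
Qed.

(** Every coordinate other than [i] contributes a kernel sum, which is 1. *)
Lemma kernel_pow_marginal n (x : n.-tuple X) (i : 'I_n) (f : Y -> R) :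
  \sum_y kernel_pow W x y * f (tnth y i) = \sum_y W (tnth x i) y * f y.
Proof.
pose F j y := W (tnth x j) y * (if j == i then f y else 1).
transitivity (\sum_(y : n.-tuple Y) \prod_j F j (tnth y j)).
  apply: eq_bigr => y _; rewrite big_split/=; congr (_ * _).
  by rewrite -big_mkcond big_pred1_eq.
rewrite sum_tuple_prod (bigD1 i) //= [X in _ * X]big1 ?mulr1.
  by apply: eq_bigr => y _; rewrite /F eqxx.
move=> j /negPf ji; rewrite -[RHS](W_sum (tnth x j)).
by apply: eq_bigr => y _; rewrite /F ji mulr1.
Qed.

Lemma ln2_gt0 : 0 < ln 2 :> R. Proof. by rewrite ln_gt0 // ltr1n. Qed.

Definition output (P : X -> R) (y : Y) : R := \sum_x P x * W x y.

Lemma output_ge (P : X -> R) x y : (forall x, 0 <= P x) ->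
  P x * W x y <= output P y.
Proof.
move=> P0; rewrite /output (bigD1 x)//= lerDl sumr_ge0 // => i _.
by rewrite mulr_ge0.
Qed.

Lemma output_ge0 (P : X -> R) y : (forall x, 0 <= P x) -> 0 <= output P y.
Proof. by move=> P0; apply: sumr_ge0 => x _; rewrite mulr_ge0. Qed.

Lemma output_sum (P : X -> R) : \sum_y output P y = \sum_x P x.
Proof.
rewrite exchange_big; apply: eq_bigr => x _.
by rewrite -mulr_sumr W_sum mulr1.
Qed.

(** [P x] cancels inside the logarithm, leaving the average divergence of [W x] from the output
    law. *)
Lemma mutual_infoE (P : X -> R) :
  mutual_info (fun x y => P x * W x y) =
  (\sum_x P x * \sum_y W x y * ln (W x y / output P y)) / ln 2.
Proof.
rewrite /mutual_info mulr_suml; apply: eq_bigr => x _.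
rewrite mulr_sumr mulr_suml; apply: eq_bigr => y _.
rewrite -mulr_sumr W_sum mulr1 /log2 !mulrA.
have [->|Px0] := eqVneq (P x) 0; first by rewrite !mul0r.
by rewrite -mulf_div divff // mul1r.
Qed.

(** [sup] dominates its set only once the set is known to be bounded above; |X| |Y| / ln 2 is a
    bound uniform in [P]. *)
Lemma mutual_info_le_capacity (P : X -> R) : is_dist P ->
  mutual_info (fun x y => P x * W x y) <= capacity W.
Proof.
move=> hP; apply: ub_le_sup; last by exists P.
exists ((\sum_(x : X) \sum_(y : Y) 1) / ln 2) => _ [{hP}P [P0 P1] <-].
rewrite mutual_infoE ler_pM2r ?invr_gt0 ?ln2_gt0 //.
apply: ler_sum => x _; rewrite mulr_sumr; apply: ler_sum => y _.
have := output_ge x y P0; set q := output P y => Pq; rewrite mulrA.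
have [->|PW0] := eqVneq (P x * W x y) 0; first by rewrite mul0r.
have PWgt : 0 < P x * W x y by rewrite lt_def PW0 mulr_ge0.
have q0 : 0 < q by apply: lt_le_trans Pq.
have Wgt : 0 < W x y.
  by rewrite lt_def W_ge0 andbT; apply: contraNneq PW0 => ->; rewrite mulr0.
have W1 : W x y <= 1.
  by rewrite -(W_sum x) (bigD1 y) //= lerDl sumr_ge0.
(* By ln t <= t - 1 <= t the term is at most (P W / q) W, and both factors are at most 1. *)
apply: (@le_trans _ _ (P x * W x y * (W x y / q))).
  rewrite ler_pM2l // (le_trans (ln_le_subr1 _)) ?divr_gt0 //.
  by rewrite gerDl lerN10.
rewrite mulrA ler_pdivrMr // mul1r; apply: le_trans Pq.
by rewrite ger_pMr.
Qed.


(** * Converse for disjoint decision regions *)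

Section converse.
Context {I : finType} (I_gt0 : (0 < #|I|)%N).

(** The law of the letter [z m] for a uniform message [m]. *)
Definition empirical (z : I -> X) (x : X) : R :=
  (\sum_m (z m == x)%:R) / #|I|%:R.

Let M_gt0 : 0 < #|I|%:R :> R. Proof. by rewrite ltr0n. Qed.

Lemma empirical_sum (z : I -> X) (g : X -> R) :
  \sum_x empirical z x * g x = (\sum_m g (z m)) / #|I|%:R.
Proof.
under eq_bigr => x _ do rewrite /empirical mulrAC mulr_suml.
rewrite -mulr_suml exchange_big /=; congr (_ / _).
apply: eq_bigr => m _; rewrite (bigD1 (z m)) //= eqxx mul1r big1 ?addr0 //.
by move=> x /negPf xz; rewrite eq_sym xz mul0r.
Qed.

Lemma empirical_dist (z : I -> X) : is_dist (empirical z).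
Proof.
split=> [x|].
  by rewrite divr_ge0 ?ler0n ?sumr_ge0 // => m _; rewrite ler0n.
under eq_bigr => x _ do rewrite -[empirical z x]mulr1.
by rewrite (empirical_sum z (fun=> 1)) sumr_const divff // gt_eqF.
Qed.

Lemma empirical_gt0 (z : I -> X) m : 0 < empirical z (z m).
Proof.
rewrite divr_gt0 // (bigD1 m) //= eqxx ltr_wpDr ?ltr01 //.
by apply: sumr_ge0 => i _; rewrite ler0n.
Qed.

Lemma coding_converse (n : nat) (x : I -> n.-tuple X)
    (S : I -> pred (n.-tuple Y)) (eps : R) :
  (forall m1 m2 y, S m1 y -> S m2 y -> m1 = m2) ->
  (forall m, 1 - eps <= \sum_(y | S m y) kernel_pow W (x m) y) ->
  (1 - eps) * log2 #|I|%:R <= n%:R * capacity W + 1.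
Proof.
move=> Sdisj Ssucc.
pose M : R := #|I|%:R.
pose P i := empirical (fun m => tnth (x m) i).
pose q i := output (P i).
pose Q (y : n.-tuple Y) := \prod_i q i (tnth y i).
pose L i a b := ln (W a b / q i b).
pose w m y := kernel_pow W (x m) y.
have PP i : is_dist (P i) := empirical_dist _.
have P_ge0 i a : 0 <= P i a by case: (PP i) => P0 _; exact: P0.
have M1 : 1 <= M by rewrite /M ler1n.
have lnM0 : 0 <= ln M by rewrite ln_ge0.
have Q_ge0 y : 0 <= Q y by apply: prodr_ge0 => i _; apply: output_ge0.
have Qsum : \sum_y Q y = 1.
  rewrite (sum_tuple_prod q) big1 // => i _.
  by rewrite output_sum; case: (PP i).
have wsum m : \sum_y w m y = 1 by exact: kernel_pow_sum.
have w_ge0 m y : 0 <= w m y by exact: kernel_pow_ge0.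
(* [Q y * k m y / M] is the weight in Gibbs' inequality; the factor 1 / M, shared with the uniform
   message, is cleared throughout. *)
pose k m y : R := (M * (S m y)%:R + 1) / 2.
(* Uses ln t <= t - 1 at t = Q k / w, and ln k >= 1[y in S_m] ln M - ln 2; this ln 2 becomes the
   extra bit in the bound. *)
have gibbs m y : w m y - Q y * k m y <=
    w m y * (\sum_i L i (tnth (x m) i) (tnth y i) + ln 2 - (S m y)%:R * ln M).
  have Sk : 0 < M * (S m y)%:R + 1.
    by case: (S m y) => /=; rewrite ?mulr1 ?mulr0; lra.
  have k0 : 0 < k m y by rewrite divr_gt0.
  have [w0|wn0] := eqVneq (w m y) 0.
    by rewrite w0 mul0r sub0r oppr_le0 mulr_ge0 // ltW.
  have w_gt0 : 0 < w m y by rewrite lt_def wn0 w_ge0.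
  have W_gt0 i : 0 < W (tnth (x m) i) (tnth y i).
    rewrite lt_def W_ge0 andbT; apply: contraNneq wn0 => W0.
    by rewrite /w /kernel_pow (bigD1 i) //= W0 mul0r.
  (* The empirical law charges every letter used by a codeword, so the output law charges every
     letter that codeword can produce. *)
  have q_gt0 i : 0 < q i (tnth y i).
    apply: lt_le_trans (output_ge (tnth (x m) i) _ (P_ge0 i)).
    by rewrite mulr_gt0 // /P empirical_gt0.
  have -> : \sum_i L i (tnth (x m) i) (tnth y i) = ln (w m y) - ln (Q y).
    rewrite /w /kernel_pow /Q !ln_prod // -sumrB; apply: eq_bigr => i _.
    by rewrite /L ln_div ?posrE.
  have Q_gt0 : 0 < Q y by apply: prodr_gt0.
  have lnk : (S m y)%:R * ln M - ln 2 <= ln (k m y).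
    rewrite /k ln_div ?posrE // lerD2r.
    case: (S m y) Sk; last by rewrite mul0r mulr0 add0r ln1.
    by rewrite mul1r mulr1 => Sk; rewrite ler_ln ?posrE ?lerDl.
  have := @ln_le_subr1 R (Q y * k m y / w m y).
  rewrite !(mulr_gt0,invr_gt0) // => /(_ isT).
  rewrite ln_div ?posrE ?mulr_gt0 // lnM ?posrE // => h.
  have -> : w m y - Q y * k m y = w m y * (1 - Q y * k m y / w m y).
    by rewrite mulrBr mulr1 [w m y * (_ / _)]mulrC divfK.
  rewrite ler_pM2l //; lra.
(* For fixed y at most one region contains y, so the [k m y] sum over m to at most (M + M) / 2. *)
have Ssum : \sum_m \sum_y Q y * k m y <= M.
  rewrite exchange_big /=; apply: (@le_trans _ _ (\sum_y Q y * M)); last first.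
    by rewrite -mulr_suml Qsum mul1r.
  apply: ler_sum => y _; rewrite -mulr_sumr ler_wpM2l // -mulr_suml.
  rewrite big_split /= -mulr_sumr sumr_const -/M ler_pdivrMr //.
  rewrite mulrDr mulr1 lerD2r ger_pMr //.
  have [m Sm|S0] := pickP (fun m => S m y).
    rewrite (bigD1 m) //= Sm big1 ?addr0 // => j jm.
    by case Sj: (S j y) => //; rewrite (Sdisj _ _ _ Sm Sj) eqxx in jm.
  by rewrite big1 // => m _; rewrite S0.
(* Marginalizing leaves a single-letter divergence per coordinate; averaging over m turns it into
   the mutual information at input law [P i]. *)
have Lsum : \sum_m \sum_y w m y * (\sum_i L i (tnth (x m) i) (tnth y i)) <=
    M * (n%:R * capacity W) * ln 2.
  under eq_bigr => m _.
    under eq_bigr => y _ do rewrite mulr_sumr.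
    rewrite exchange_big /=.
    under eq_bigr => i _ do
      rewrite (kernel_pow_marginal (x m) i (L i (tnth (x m) i))).
    over.
  have -> : M * (n%:R * capacity W) * ln 2 =
      \sum_(i < n) M * capacity W * ln 2.
    by rewrite sumr_const card_ord -mulr_natl; ring.
  rewrite exchange_big /=.
  apply: ler_sum => i _.
  have := mutual_info_le_capacity (PP i).
  rewrite mutual_infoE empirical_sum ler_pdivrMr ?ln2_gt0 //.
  by rewrite ler_pdivrMr // [_ * #|I|%:R]mulrC mulrA => h; exact: h.
have : \sum_m \sum_y (w m y - Q y * k m y) <=
    \sum_m (\sum_y w m y * (\sum_i L i (tnth (x m) i) (tnth y i)) + ln 2
            - (1 - eps) * ln M).
  apply: ler_sum => m _; apply: (le_trans (ler_sum _ (fun y _ => gibbs m y))).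
  under eq_bigr => y _ do rewrite mulrBr mulrDr mulrA.
  rewrite sumrB big_split /= -mulr_suml wsum mul1r lerD2l lerN2 -mulr_suml.
  (* As ln M >= 0, the success probability can be replaced by its lower bound 1 - eps. *)
  rewrite ler_wpM2r //.
  under eq_bigr => y _ do rewrite mulr_natr mulrb.
  by rewrite -big_mkcond.
(* The left side is M minus a total that [Ssum] bounds by M, hence nonnegative; what remains is the
   claim times M ln 2. *)
rewrite sumrB big_split /= !sumr_const.
under eq_bigr => m _ do rewrite sumrB wsum.
rewrite sumrB sumr_const => h.
rewrite /log2 [_ * (_ / _)]mulrA ler_pdivrMr ?ln2_gt0 // -(ler_pM2l M_gt0) -/M.
move: h Lsum Ssum; rewrite -(mulr_natl (ln 2)) -(mulr_natl ((1 - eps) * _)) -/M.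
set G := \sum_m \sum_y w m y * _; set H := \sum_m \sum_y Q y * _.
move: G H (ln M) (ln 2) (capacity W) => G H lM l2 C.
lra.
Qed.

End converse.

(** Adds the empty index set, where [log2 0] evaluates to 0 and the claim reduces to 0 <= n C +
    1. *)
Lemma coding_converse_rate (I : finType) (n : nat) (x : I -> n.-tuple X)
    (S : I -> pred (n.-tuple Y)) (eps : R) :
  0 <= eps < 1 ->
  (forall m1 m2 y, S m1 y -> S m2 y -> m1 = m2) ->
  (forall m, 1 - eps <= \sum_(y | S m y) kernel_pow W (x m) y) ->
  log2 #|I|%:R <= (n%:R * capacity W + 1) / (1 - eps).
Proof.
move=> /andP[_ eps1] Sdisj Ssucc; rewrite ler_pdivlMr ?subr_gt0 // mulrC.
have [I0|I_gt0] := posnP #|I|; last exact: coding_converse Sdisj Ssucc.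
rewrite I0 /log2 ln0 // mul0r mulr0.
have [x0 _|X0] := pickP (fun _ : X => true).
  (* For one message whose region is everything, with eps = 0, the converse reads exactly 0 <= n C +
     1. *)
  have := @coding_converse unit _ n (fun=> [tuple x0 | i < n])
    (fun _ => predT) 0.
  rewrite card_unit /log2 ln1 mul0r mulr0; apply=> //; first by case; case.
  by move=> m; rewrite subr0 kernel_pow_sum.
(* Without input letters there is no input distribution, and [sup] of the empty set is 0. *)
suff -> : capacity W = 0 by rewrite mulr0 add0r.
rewrite /capacity (_ : [set _ | _ in _] = set0) ?sup0 //.
rewrite -subset0 => z [P [_ Psum] _]; move/eqP: Psum.
rewrite big1 => [|a _]; first by rewrite eq_sym oner_eq0.
by have := X0 a.
Qed.

End channel.

(** * Atoms, and nonnegativity of the distortions *)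

Lemma Atom_sub (U : countType) (ps : proof_system U) (SO : {fset U})
    (order : seq U) : (Atom ps SO order `<=` SO)%fset.
Proof.
(* The starting set is generalized because each deletion changes it. *)
rewrite /Atom; elim: order SO => [|s order ih] A /=; first exact: fsubset_refl.
case: ifP => _; last exact: ih.
exact: fsubset_trans (ih _) (fsubD1set _ _).
Qed.

Section distortion.
Context {R : realType} {U : countType} (ps : proof_system U).
Context (J : set U -> set U -> R) (hJ : forall A B, 0 <= J A B <= 1).

Lemma jaccard_le1 A B : jaccard J A B <= 1.
Proof.
rewrite /jaccard; case: ifPn => [/asboolP fAB|_]; last by case/andP: (hJ A B).
have fI : finite_set (A `&` B).
  by apply: sub_finite_set fAB => x [Ax _]; left.
have le_card : (#|` fset_set (A `&` B)| <= #|` fset_set (A `|` B)|)%N.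
  by apply: fsubset_leq_card; rewrite -fset_set_sub // => x [Ax _]; left.
have [c0|c_gt0] := posnP #|` fset_set (A `|` B)|.
  by rewrite c0 invr0 mulr0.
by rewrite ler_pdivrMr ?ltr0n // mul1r ler_nat.
Qed.

Lemma dCn_ge0 G s t : 0 <= dCn ps J G s t.
Proof. by rewrite subr_ge0 jaccard_le1. Qed.

Lemma dDd_ge0 SO order s t : 0 <= dDd R ps SO order s t.
Proof.
rewrite /dDd; case: ifP => // _; apply: fine_ge0.
rewrite le_min lee01 andbT mule_ge0 ?abse_ge0 // inve_ge0.
by rewrite le_max lee01 orbT.
Qed.

Lemma dsem_ge SO order G alpha beta gamma s t : 0 <= beta -> 0 <= gamma ->
  alpha * dH R s t <= dsem ps J SO order G alpha beta gamma s t.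
Proof.
move=> b0 g0; rewrite /dsem -addrA lerDl addr_ge0 // mulr_ge0 //.
  exact: dCn_ge0.
exact: dDd_ge0.
Qed.

End distortion.

(** * Error events of semantic codes *)

Section code.
Context {R : realType} {U : countType} {SO SOh : {fset U}} {SC SCh : finType}.
Context (W : SC -> SCh -> R) (hW : markov_kernel W).
Context {n M : nat} (c : semantic_code SO SOh SC SCh n M).

Lemma Pr_predC (m : msgs c) (E : pred U) : Pr W m (predC E) = 1 - Pr W m E.
Proof.
rewrite -(kernel_pow_sum hW (enc m)) /Pr.
by rewrite [in RHS](bigID (fun y => E (val (dec c y)))) /= addrAC subrr add0r.
Qed.

Lemma Pr_le_Pe (m : msgs c) : Pr W m (fun t => t != val m) <= Pe W c.
Proof. exact: le_bigmax. Qed.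

Lemma Pe_ge0 : 0 <= Pe W c. Proof. exact: bigmax_ge_id. Qed.

(** Markov's inequality: [d] is at least [alpha] on the error event and nonnegative off it. *)
Lemma Pe_le_Dmax (d : U -> U -> R) (alpha : R) : 0 < alpha ->
  (forall s t, 0 <= d s t) -> (forall s t, alpha * dH R s t <= d s t) ->
  alpha * Pe W c <= Dmax W c d.
Proof.
move=> a0 d_ge0 d_ge; rewrite mulrC -ler_pdivlMr //; apply: bigmax_le => [|m _].
  by rewrite divr_ge0 ?(ltW a0) //; exact: bigmax_ge_id.
rewrite ler_pdivlMr //; apply: le_trans (le_bigmax _ _ m).
rewrite /Pr mulr_suml /Ex big_mkcond; apply: ler_sum => y _.
have w_ge0 := kernel_pow_ge0 hW (enc m) y.
case: ifPn => [tm|_]; last by rewrite mulr_ge0.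
rewrite ler_wpM2l // (le_trans _ (d_ge _ _)) //.
by rewrite /dH eq_sym tm mulr1.
Qed.

Lemma log_card_le_capacity (eps : R) : 0 <= eps < 1 -> Pe W c <= eps ->
  log2 M%:R <= (n%:R * capacity W + 1) / (1 - eps).
Proof.
move=> eps01 Peps; rewrite -(msgs_card c) cardfE.
apply: (coding_converse_rate hW (x := @enc _ _ _ _ _ _ _ c)
  (S := fun m y => val (dec c y) == val m) eps01).
  by move=> m1 m2 y /eqP dec_m1 /eqP dec_m2; apply: val_inj; rewrite -dec_m1.
move=> m; rewrite lerBlDr -lerBlDl.
rewrite -[leLHS](Pr_predC m (fun t => t == val m)).
exact: le_trans (Pr_le_Pe m) Peps.
Qed.

Lemma log_card_Atom_le_capacity (ps : proof_system U)
    (J : set U -> set U -> R) (order : seq U) (eps : R) :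
  (forall A B, 0 <= J A B <= 1) ->
  (forall a1 a2 : U,
     a1 \in Atom ps SO order -> a2 \in Atom ps SO order -> a1 <> a2 ->
     RCn ps J SO SOh a1 `&` RCn ps J SO SOh a2 = set0) ->
  (Atom ps SO order `<=` msgs c)%fset -> 0 <= eps < 1 -> PeCn ps J W c <= eps ->
  log2 #|` Atom ps SO order|%:R <= (n%:R * capacity W + 1) / (1 - eps).
Proof.
move=> hJ RCn_disj Amsgs eps01 Peps; rewrite cardfE.
(* Stated as the complement of the event in [PeCn], so that its probability is at least 1 - eps;
   [dCn_ge0] turns it into membership in [RCn]. *)
pose S (a : Atom ps SO order) (y : n.-tuple SCh) :=
  ~~ (0 < dCn ps J SO (val a) (val (dec c y))).
have S_RCn a y : S a y -> RCn ps J SO SOh (val a) (val (dec c y)).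
  rewrite /S -leNgt => d0; split; first exact: valP.
  by apply/le_anti; rewrite d0 dCn_ge0.
(* [fincl] restricts the encoder to the atoms; the decoder is unchanged. *)
apply: (coding_converse_rate hW (x := fun a => enc (fincl Amsgs a)) (S := S)
  eps01).
  move=> a1 a2 y S1 S2; apply: val_inj; apply: contrapT => a12.
  have : (RCn ps J SO SOh (val a1) `&` RCn ps J SO SOh (val a2))
      (val (dec c y)).
    by split; exact: S_RCn.
  by rewrite (RCn_disj _ _ (valP a1) (valP a2) a12).
move=> a; rewrite lerBlDr -lerBlDl.
pose E t := 0 < dCn ps J SO (val a) t.
have := Pr_predC (fincl Amsgs a) E; rewrite {1}/Pr /= => ->.
rewrite subKr; apply: le_trans Peps.
exact: (le_bigmax 0 (fun m => Pr W m (fun t => 0 < dCn ps J SO (val m) t))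
  (fincl Amsgs a)).
Qed.

End code.

Theorem theorem6 (R : realType) (U : countType) (ps : proof_system U)
    (J : set U -> set U -> R) (hJ : forall X Y, 0 <= J X Y <= 1)
    (SO SOh : {fset U}) (order : seq U) (horder : canonical_order SO order)
    (SC SCh : finType) (W : SC -> SCh -> R) (hW : markov_kernel W) :
  [/\
    (* (i) *)
    forall (n M : nat) (c : semantic_code SO SOh SC SCh n M) (eps : R),
      0 <= eps < 1 -> Pe W c <= eps ->
      log2 M%:R <= (n%:R * capacity W + 1) / (1 - eps),
    (* (ii) *)
    forall (alpha beta gamma : R) (G : {fset U}),
      0 < alpha -> 0 <= beta -> 0 <= gamma -> alpha + beta + gamma = 1 ->
      let d := dsem ps J SO order G alpha beta gamma in
      (forall (n M : nat) (c : semantic_code SO SOh SC SCh n M),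
         alpha * Pe W c <= Dmax W c d) /\
      (forall (M : nat -> nat) (c : forall n, semantic_code SO SOh SC SCh n (M n)),
         (fun n => Dmax W (c n) d) @ \oo --> (0 : R) ->
         (fun n => Pe W (c n)) @ \oo --> (0 : R) /\
         (forall eps : R, 0 < eps < 1 ->
            \forall n \near \oo,
              log2 (M n)%:R <= (n%:R * capacity W + 1) / (1 - eps))),
    (* (iii) *)
    (forall a1 a2 : U,
       a1 \in Atom ps SO order -> a2 \in Atom ps SO order -> a1 <> a2 ->
       RCn ps J SO SOh a1 `&` RCn ps J SO SOh a2 = set0) ->
    forall (n : nat) (c : semantic_code SO SOh SC SCh n #|` SO|) (eps : R),
      msgs c = SO -> 0 <= eps < 1 -> PeCn ps J W c <= eps ->
      log2 #|` Atom ps SO order|%:R <= (n%:R * capacity W + 1) / (1 - eps) &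
    (* (iv) *)
    forall (M : nat) (Ms : {fset U}),
      (Ms `<=` SO)%fset -> #|` Ms| = M -> (M <= #|` SO|)%N].
Proof.
split.
- by move=> n M c eps; exact: log_card_le_capacity.
- move=> alpha beta gamma G a0 b0 g0 _ d.
  have alpha_dH_le s t : alpha * dH R s t <= d s t by exact: dsem_ge.
  have d_ge0 s t : 0 <= d s t.
    by apply: le_trans (alpha_dH_le s t); rewrite mulr_ge0 ?ler0n // ltW.
  have alpha_Pe_le n M (c : semantic_code SO SOh SC SCh n M) :
    alpha * Pe W c <= Dmax W c d by exact: Pe_le_Dmax.
  split=> [//|M c D0].
  have Pe0 : (fun n => Pe W (c n)) @ \oo --> (0 : R).
    (* Squeeze: 0 <= Pe <= Dmax / alpha. *)
    apply: (@squeeze_cvgr _ _ _ _ (fun=> 0)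
      (fun n => alpha^-1 * Dmax W (c n) d)).
    + by near=> n; rewrite Pe_ge0 /= ler_pdivlMl.
    + exact: cvg_cst.
    + rewrite -[X in _ --> X](mulr0 alpha^-1); apply: cvgM D0.
      exact: cvg_cst.
  split=> // eps /andP[eps0 eps1].
  (* Since eps > 0, the error is eventually at most eps, and (i) applies from then on. *)
  near=> n; apply: (log_card_le_capacity hW (c := c n)); first by rewrite ltW.
  by near: n; exact: (cvgr_le _ Pe0).
- move=> RCn_disj n c eps msgsE.
  apply: (log_card_Atom_le_capacity hW hJ RCn_disj).
  by rewrite msgsE Atom_sub.
- by move=> M Ms MsSO <-; exact: fsubset_leq_card.
Unshelve. all: by end_near.
Qed.
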